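(* Let $q$ be any prime power, let $\ell\geq3$ and $t\geq2$ be integers, and put $m=\ell t$, $I=1$, $J=2$, $K=J-I=1$, $F=\mathbb{F}_{q^m}$. There exists $A=(\alpha_1,\ldots,\alpha_\ell)\in(F^* )^\ell$ such that $\kappa_A^{1,2}$ is not a $C_{1,\ell}$-th power in $F$, $\Pi_{\delta+2}/\Pi_2$ is not a $(q^{\ell}-1)$-st power in $F$ for some $\delta\in\{1,\ldots,\ell-1\}$, and, for every integer $s$ with $1\leq s<(m-2)/2$ and every $s$-dimensional $\mathbb{F}_q$-subspace $B\leq F$, the columns of the matrix $G_{A,B}$ (see context) span over $\mathbb{F}_q$ an extremal $(m-3)$-scattered $$[\ell m+s,\ell(m-2)+s]_{q^m/q}$$ $q$-system whose dual code $D$ (the dual of the code associated with the system, i.e. the $F$-row space of $H_{A,B}$) satisfies $d_2(D)\geq2m-4$ and is not equivalent to any order-one direct-sum code $D_{\mathbf{s}}$ with total surplus $s$, that is, with $\mathbf{s}=(s_1,\ldots,s_\ell)$, $s_i\ge0$, $s_1+\cdots+s_\ell=s$.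
   Context: Notation (with $I=1$, $J=2$, $K=1$). Subscripts of the $\alpha_i$ and $\Pi_i$ are read cyclically modulo $\ell$. Put $C_{a,r}=\frac{q^{ar}-1}{q^a-1}$, $$\kappa_A^{1,2}=\frac{\alpha_1^{q^{\ell-2}}\prod_{u=3}^{\ell}\alpha_u^{q^{u-3}}}{\alpha_2^{C_{1,\ell-1}}},\qquad \Pi_i=\alpha_i^{q^{\ell-1}}\alpha_{i-1}^{q^{\ell-2}}\cdots\alpha_{i+2}^{q}\alpha_{i+1}=\prod_{j=0}^{\ell-1}\alpha_{i-j}^{q^{\ell-1-j}}.$$ For a positive integer $r$, $c\in F^*$ is an $r$-th power in $F$ if $c=v^r$ for some $v\in F^*$. For $x=(x_1,\ldots,x_\ell)\in F^\ell$ let $f_i(x)=x_i^{q}+\alpha_{i+1}x_{i+1}^{q^2}$ for $1\leq i<\ell$ and $f_\ell(x)=x_\ell^{q}+\alpha_1x_1^{q^2}$, and $$W_A^{1,2}=\{(x_1,\ldots,x_\ell,f_1(x),\ldots,f_\ell(x)):x\in F^\ell\}\leq F^{2\ell}.$$ Let $H_0\in F^{2\ell\times\ell m}$ have as columns an $\mathbb{F}_q$-basis of $W_A^{1,2}$. Let $b_1,\ldots,b_s$ be an $\mathbb{F}_q$-basis of $B$ and let $Z_B\in F^{2\ell\times s}$ have columns $(0,\ldots,0,b_j,0,\ldots,0)^\top$ with $b_j$ in position $\ell+1$ (the position of $f_1$). Put $H_{A,B}=[H_0\mid Z_B]$, and let $G_{A,B}$ be any generator matrix of the dual of the $F$-row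 space of $H_{A,B}$. Systems. An $[n,k]_{q^m/q}$ $q$-system is an $n$-dimensional $\mathbb{F}_q$-subspace $U\leq F^k$ with $\langle U\rangle_F=F^k$. It is $h$-scattered if $\dim_{\mathbb{F}_q}(U\cap H)\leq h$ for every $h$-dimensional $F$-subspace $H\leq F^k$, and then extremal if $n=\lfloor km/(h+1)\rfloor$. Codes. An $[n,r]_{q^m/q}$ code is an $r$-dimensional $F$-subspace $C\leq F^n$. The rank weight of $x\in F^n$ is the $\mathbb{F}_q$-dimension of the span of its coordinates; $d(C)$ is the minimum rank weight of a nonzero word, and $[n,r,d]_{q^m/q}$ means $d(C)=d$. $C^\perp=\{y: xy^\top=0\ \forall x\in C\}$. A code is nondegenerate if the columns of a generator matrix are $\mathbb{F}_q$-independent; the $\mathbb{F}_q$-span of the columns is then a $q$-system, and code and system are called associated. Expanding $x\in F^n$ over an $\mathbb{F}_q$-basis of $F$ as an $m\times n$ matrix, $\operatorname{Rsupp}_q(x)$ is its row space; $\operatorname{Rsupp}_q(V)$ is the sum of supports of an $F$-basis of $V$; $d_2(C)=\min\{\dim_{\mathbb{F}_q}\operatorname{Rsupp}_q(V): V\leq C,\dim_FV=2\}$. Codes $C,C'\leq F^n$ are (rank-metric) equivalent if $C'=\sigma(C)M$ with $M\in\operatorname{GL}(n,q)$ and $\sigma\in\operatorname{Aut}(F)$ (full field automorphism group). For nonnegative integers $\mathbf{s}=(s_1,\ldots,s_\ell)$ with sum $s$, an order-one direct-sum code is $D_{\mathbf{s}}=D_{s_1}\oplus\cdots\oplus D_{s_\ell}$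 on disjoint coordinate blocks, where each $D_{s_i}$ is any nondegenerate $[m+s_i,2,m-1]_{q^m/q}$ code. *)

(* Defs.v *)
(* F is a finite extension of Fq, and q is #|Fq|.
   - F^n seen as an F_q-space is {ffun 'I_n -> F}, so that F_q-subspaces are
     terms of type {vspace {ffun 'I_n -> F}}.
   - An F-subspace of F^n is the row space of a matrix with n columns, as in
     mxalgebra; in particular a code is given by any matrix spanning it.
   - Tuples and ordinals are 0-based: x_1 is tnth x 0. *)
From HB Require Import structures.
From mathcomp Require Import all_boot all_algebra.
From mathcomp Require Import pgroup abelian fieldext finfield.

Set Implicit Arguments.
Unset Strict Implicit.
Unset Printing Implicit Defensive.

Import GRing.Theory.
Local Open Scope ring_scope.

(* C_{a,r}; the division is exact. *)
Definition Cnum (q a r : nat) : nat := ((q ^ (a * r) - 1) %/ (q ^ a - 1))%N.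

Definition is_power (F : fieldType) (r : nat) (c : F) : Prop :=
  exists2 v : F, v != 0 & c = v ^+ r.

Section Systems.
Variables (Fq : finFieldType) (F : fieldExtType Fq).

Definition fcol k n (M : 'M[F]_(k, n)) (j : 'I_n) : {ffun 'I_k -> F} :=
  [ffun i => M i j].

Definition cols k n (M : 'M[F]_(k, n)) : n.-tuple {ffun 'I_k -> F} :=
  [tuple fcol M j | j < n].

Definition row_of k (x : {ffun 'I_k -> F}) : 'rV[F]_k := \row_i x i.

(* An F_q-basis of U spans the same F-subspace as U. *)
Definition Fspan k (U : {vspace {ffun 'I_k -> F}}) : 'M[F]_(\dim U, k) :=
  \matrix_(i < \dim U) row_of (tnth (vbasis U) i).

Definition q_system (n k : nat) (U : {vspace {ffun 'I_k -> F}}) : Prop :=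
  \dim U = n /\ row_full (Fspan U).

Definition coker_map r k (H : 'M[F]_(r, k)) (x : {ffun 'I_k -> F}) :
  {ffun 'I_k -> F} := [ffun j => (row_of x *m cokermx H) 0 j].

Lemma coker_map_linear r k (H : 'M[F]_(r, k)) : linear (coker_map H).
Proof.
move=> a x y; apply/ffunP=> j; rewrite !ffunE !mxE.
rewrite scaler_sumr -big_split; apply: eq_bigr => i _ /=.
by rewrite !mxE !ffunE mulrDl scalerAl.
Qed.

HB.instance Definition _ r k (H : 'M[F]_(r, k)) :=
  GRing.isLinear.Build Fq _ _ _ (coker_map H) (coker_map_linear H).

(* The row space of H as an F_q-subspace, see mem_restrict. *)
Definition restrict r k (H : 'M[F]_(r, k)) : {vspace {ffun 'I_k -> F}} :=
  lker (linfun (coker_map H)).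

Lemma mem_restrict r k (H : 'M[F]_(r, k)) x :
  (x \in restrict H) = (row_of x <= H)%MS.
Proof.
rewrite memv_ker lfunE /= submxE; apply/eqP/eqP=> [e | e].
  apply/rowP=> j; have := congr1 (fun f : {ffun _} => f j) e.
  by rewrite !ffunE mxE => ->; rewrite mxE.
by apply/ffunP=> j; rewrite !ffunE e mxE.
Qed.

Definition scattered (h k : nat) (U : {vspace {ffun 'I_k -> F}}) : Prop :=
  forall H : 'M[F]_k, \rank H = h -> (\dim (U :&: restrict H) <= h)%N.

Definition extremal_scattered (h k : nat) (U : {vspace {ffun 'I_k -> F}}) : Prop :=
  scattered h U /\ \dim U = ((k * \dim {:F}) %/ h.+1)%N.

Definition rank_weight n (x : 'rV[F]_n) : nat :=
  \dim <<[seq x 0 j | j <- enum 'I_n]>>.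

Definition has_min_distance r n (C : 'M[F]_(r, n)) (d : nat) : Prop :=
  (exists2 x : 'rV[F]_n, (x <= C)%MS && (x != 0) & rank_weight x = d) /\
  (forall x : 'rV[F]_n, (x <= C)%MS -> x != 0 -> (d <= rank_weight x)%N).

Definition dual_code r n (C : 'M[F]_(r, n)) : 'M[F]_n := kermx C^T.

Definition generator_matrix k r n (G : 'M[F]_(k, n)) (C : 'M[F]_(r, n)) : Prop :=
  row_free G /\ (G == C)%MS.

Definition nondegenerate_code k n (G : 'M[F]_(k, n)) : Prop := free (cols G).

(* The row space of expand x does not depend on the basis of F used. *)
Definition expand n (x : 'rV[F]_n) : 'M[Fq]_(\dim {:F}, n) :=
  \matrix_(i, j) coord (vbasis {:F}) i (x 0 j).

(* Support of the row space of V when V is row_free: its rows are then an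
   F-basis of that space. *)
Definition Rsupp r n (V : 'M[F]_(r, n)) : 'M[Fq]_n :=
  (\sum_(i < r) <<expand (row i V)>>)%MS.

Definition has_d2 r n (C : 'M[F]_(r, n)) (d : nat) : Prop :=
  (exists2 V : 'M[F]_(2, n), row_free V && (V <= C)%MS & \rank (Rsupp V) = d) /\
  (forall V : 'M[F]_(2, n), row_free V -> (V <= C)%MS -> (d <= \rank (Rsupp V))%N).

Definition code_equiv r r' n (C : 'M[F]_(r, n)) (C' : 'M[F]_(r', n)) : Prop :=
  exists (sigma : {rmorphism F -> F}) (M : 'M[Fq]_n),
    [/\ bijective sigma, M \in unitmx
      & (C' == map_mx sigma C *m map_mx (in_alg F) M)%MS].

(* With m = [F : F_q]; C is the row space of a block diagonal matrix whose
   blocks are generator matrices of the summands. *)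
Definition order_one_direct_sum l (s : 'I_l -> nat) r n (C : 'M[F]_(r, n)) : Prop :=
  let m := \dim {:F} in
  exists (D : forall i : 'I_l, 'M[F]_(2, m + s i))
         (e : (\sum_(i < l) (m + s i))%N = n),
    (forall i, [/\ row_free (D i), nondegenerate_code (D i)
                 & has_min_distance (D i) (m - 1)]) /\
    (C == castmx (erefl, e)
            (\mxblock_(i < l, j < l) (if i == j then D j else 0)))%MS.

End Systems.

Section Construction.
Variables (Fq : finFieldType) (F : fieldExtType Fq) (l : nat).
Implicit Type A : l.-tuple F.
Let q := #|Fq|.

(* alpha_i, with 1-based subscripts read modulo l *)
Definition alpha A (i : nat) : F := A`_((i + l).-1 %% l)%N.

Definition kappa A : F :=
  alpha A 1 ^+ (q ^ (l - 2)) * (\prod_(3 <= u < l.+1) alpha A u ^+ (q ^ (u - 3)))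
  / alpha A 2 ^+ Cnum q 1 (l - 1).

(* i + l - j is i - j modulo l, without truncation. *)
Definition Pi A (i : nat) : F :=
  \prod_(j < l) alpha A (i + l - j)%N ^+ (q ^ (l - 1 - j)).

(* ordS is the cyclic successor. *)
Definition fA A (x : {ffun 'I_l -> F}) (i : 'I_l) : F :=
  x i ^+ q + tnth A (ordS i) * x (ordS i) ^+ (q ^ 2).

Definition graphA A (x : {ffun 'I_l -> F}) : {ffun 'I_(l + l) -> F} :=
  [ffun k => match split k with inl i => x i | inr i => fA A x i end].

Lemma q_pnat : [pchar F].-nat q.
Proof.
have [p p_pr pF] := finPcharP Fq.
have pL : p \in [pchar F] by rewrite (fmorph_pchar (in_alg F)).
rewrite (eq_pnat _ (pcharf_eq pL)) /q -cardsT.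
exact: abelem_pgroup (fin_ring_pchar_abelem pF).
Qed.

Lemma frob_linear n (a : Fq) (x y : F) :
  (a *: x + y) ^+ (q ^ n) = a *: x ^+ (q ^ n) + y ^+ (q ^ n).
Proof.
rewrite exprDn_pchar ?pnatX ?q_pnat // exprZn; congr (_ *: _ + _).
by elim: n => // n IHn; rewrite expnS exprM expf_card.
Qed.

Lemma graphA_linear A : linear (graphA A).
Proof.
move=> a x y; apply/ffunP=> k; rewrite !ffunE.
case: (split k) => i; rewrite ?ffunE // /fA !ffunE.
have /= := frob_linear 1 a (x i) (y i); rewrite expn1 => ->.
by rewrite frob_linear scalerDr mulrDr scalerAr addrACA.
Qed.

HB.instance Definition _ A :=
  GRing.isLinear.Build Fq _ _ _ (graphA A) (graphA_linear A).

Definition WA A : {vspace {ffun 'I_(l + l) -> F}} := limg (linfun (graphA A)).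

Lemma mem_WA A y : reflect (exists x, y = graphA A x) (y \in WA A).
Proof.
apply: (iffP memv_imgP) => [[x _ ->] | [x ->]].
  by exists x; rewrite lfunE.
by exists x; rewrite ?memvf // lfunE.
Qed.

(* Row l (0-based) is the position of f_1. *)
Definition ZB s (b : s.-tuple F) : 'M[F]_(l + l, s) :=
  \matrix_(i, j) (if i == l :> nat then tnth b j else 0).

Definition HAB n s (H0 : 'M[F]_(l + l, n)) (b : s.-tuple F) :
  'M[F]_(l + l, n + s) := row_mx H0 (ZB b).

End Construction.

(* Main.v *)
Require Import Defs.
From HB Require Import structures.
From mathcomp Require Import all_boot all_order all_algebra.
From mathcomp Require Import falgebra fieldext finfield.
From mathcomp Require Import ring zify.
Set Implicit Arguments.
Unset Strict Implicit.
Unset Printing Implicit Defensive.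
Import GRing.Theory.
Local Open Scope ring_scope.

(** Everything rests on lower bounds for supports in the row space of
    [H_{A,B}].  A nonzero word [Y *m H_{A,B}] has rank weight at least [m - 1]
    ([word_support_ge]), and two independent words have a joint support of
    dimension at least [2 * m - 4] ([plane_support_ge]).  Both
    come from the columns spanning [W_A].

    Let [Y] have [r] independent rows, with coefficients [a_(k,j)] on the
    coordinates [x] and [b_(k,j)] on the coordinates [f], and let [c] be the
    dimension of the support of [Y *m H_{A,B}].  The values [Y *m (x, f x)] lie
    in an [Fq]-subspace of [F ^ r] of dimension [c], whose annihilator for the
    trace form has dimension at least [r * m - c] ([trace_annihilator]).
    Taking adjoints ([annihilator_equations]), each [y] in the annihilator
    satisfies, for every [j] modulo [l],
      [sum_k a_(k,j+1)^(q^2) y_k^(q^2) + b_(k,j+1)^q y_k^q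
             + alpha_(j+1) b_(k,j) y_k = 0],
    and it remains to bound the space of solutions by 1 when [r = 1] and by 4
    when [r = 2].

    The hypothesis that [kappa_A] is not a [C_(1,l)]-th power enters only here:
    it says that for [b] nonzero the vectors [(b_(j+1)^q)_j] and
    [(alpha_(j+1) b_j)_j] are independent ([shift_independent]), since a
    proportionality is a recurrence which, followed once round the cycle,
    exhibits [kappa_A] as a power.  For [r = 1] this allows an elimination that
    leaves a nonzero equation of order one ([solutions_le1]).  For [r = 2],
    either the two vectors [a] are independent and the system is equivalent to
    one of order one in four unknowns ([solutions_le_double]), or one of them
    may be taken to be zero; then the corresponding unknown can be eliminated,
    and the other one satisfies a nonzero equation of order at most three
    ([solutions_le3]).

    The weight bound makes the columns of [H_{A,B}] a system whose dual is
    [(m - 3)]-scattered: too many vectors of that dual in a subspace would give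
    a word of weight at most [m - 2] ([dual_scattered]).  The bound on planes
    is the bound on [d_2].  Finally a direct sum code contains a plane of
    support at most [m + s], less than [2 * m - 4] ([direct_sum_thin]), and
    equivalence preserves supports ([equiv_thin]).

    As for [A], all entries can be 1 but [alpha_3 = g]: then [kappa_A] and
    [Pi_2] are [g], [Pi_3] is [g ^ (q ^ (l - 1))], and a count of roots provides
    a suitable [g] ([nonpower_exists]). *)

(** * The q-power Frobenius *)

Section Frobenius.
Variables (Fq : finFieldType) (F : fieldExtType Fq).
Local Notation q := #|Fq|.
Local Notation m := (\dim {:F}).
Local Notation up := (map_mx (in_alg F)).

Lemma dimF_gt0 : (0 < m)%N.
Proof. exact: (adim_gt0 (aspacef F)). Qed.

Lemma order_gt1 : (1 < q)%N.
Proof. exact: finNzRing_gt1. Qed.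

Lemma expr_order (x : F) : x ^+ (q ^ m) = x.
Proof. by apply/eqP; rewrite -(Fermat's_little_theorem (aspacef F)) memvf. Qed.

Definition frob (x : F) : F := x ^+ q.

Lemma frob_is_nmod_morphism : nmod_morphism frob.
Proof.
split=> [|x y]; first by rewrite /frob expr0n -[q]prednK ?(ltnW order_gt1).
by have := frob_linear 1 1 x y; rewrite !scale1r expn1.
Qed.

Lemma frob_is_monoid_morphism : monoid_morphism frob.
Proof. by split=> [|x y]; rewrite /frob ?expr1n ?exprMn. Qed.

HB.instance Definition _ := GRing.isNmodMorphism.Build F F frob frob_is_nmod_morphism.
HB.instance Definition _ := GRing.isMonoidMorphism.Build F F frob frob_is_monoid_morphism.

Lemma iter_frob n (x : F) : iter n frob x = x ^+ (q ^ n).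
Proof.
elim: n => [|n IHn]; first by rewrite expr1.
by rewrite iterS IHn /frob -exprM -expnSr.
Qed.

Lemma frob_surj (x : F) : exists y, x = frob y.
Proof.
exists (x ^+ (q ^ m.-1)).
by rewrite /frob -exprM -expnSr prednK ?dimF_gt0 ?expr_order.
Qed.

Lemma frob_alg a : frob a%:A = a%:A.
Proof. by rewrite /frob exprZn expr1n expf_card. Qed.

Lemma frob_fixed (x : F) : frob x = x -> exists a : Fq, x = a%:A.
Proof.
move=> fx; have: x \in 1%AS.
  by rewrite Fermat's_little_theorem dimv1 expn1; apply/eqP.
by case/vlineP=> a ->; exists a.
Qed.

Lemma map_frob_up n p (N : 'M[Fq]_(n, p)) : map_mx frob (up N) = up N.
Proof. by apply/matrixP=> i j; rewrite !mxE frob_alg. Qed.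

Lemma fixed_up n p (V : 'M[F]_(n, p)) :
  map_mx frob V = V -> exists N : 'M[Fq]_(n, p), V = up N.
Proof.
move=> fV; have fx i j : {a : Fq | V i j == a%:A}.
  apply: sigW; have /frob_fixed[a ->] : frob (V i j) = V i j.
    by rewrite -[in RHS]fV mxE.
  by exists a.
exists (\matrix_(i, j) sval (fx i j)); apply/matrixP=> i j; rewrite !mxE /=.
exact/eqP/(svalP (fx i j)).
Qed.

(** * Independence over the base field *)

(** The rows are kept together in a matrix, so that a semilinear system for a
    family of solutions becomes one matrix equation. *)
Definition Fq_free p n (V : 'M[F]_(p, n)) :=
  forall c : 'rV[Fq]_p, up c *m V = 0 -> c = 0.

(** A system [v ^ q = v *m M] of order one in [n] unknowns has at most [n]
    solutions independent over [Fq].  The reason is descent: if one solution is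
    a combination of [F]-independent ones, applying Frobenius to the relation
    shows that its coefficients are fixed by Frobenius, hence lie in [Fq]. *)
Lemma Fq_free_rank p n (V : 'M[F]_(p, n)) (M : 'M[F]_n) :
  Fq_free V -> map_mx frob V = V *m M -> (p <= n)%N.
Proof.
move=> freeV fV; suff: row_free V by move/eqP <-; apply: rank_leq_col.
rewrite -row_leq_rank leqNgt; apply/negP=> ltVp.
pose f := maxrankfun V; pose V0 := rowsub f V.
have [i Nif] : exists i : 'I_p, i \notin codom f.
  apply/existsP; rewrite -negb_forall; apply: contraL ltVp => /forallP allf.
  rewrite -leqNgt -[X in (X <= _)%N]card_ord -[X in (_ <= X)%N]card_ord.
  rewrite -(card_codom (@maxrankfun_inj _ _ _ V)).
  by apply/subset_leq_card/subsetP=> j _; apply: allf.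
have freeV0 : row_free V0 by apply: maxrowsub_free.
have /submxP[c Dc] : (row i V <= V0)%MS.
  by rewrite (eq_maxrowsub V) row_sub.
have fc : map_mx frob c = c.
  have fV0 : map_mx frob V0 = V0 *m M by rewrite map_mxsub fV mul_rowsub_mx.
  have : row_free (map_mx frob V0) by rewrite row_free_map.
  move/row_free_inj; apply; rewrite -map_mxM -Dc fV0 mulmxA -Dc.
  by rewrite map_row fV row_mul.
have [d Dd] := fixed_up fc.
pose e : 'rV[Fq]_p := delta_mx 0 i - \sum_j d 0 j *: delta_mx 0 (f j).
have /freeV/rowP/(_ i) : up e *m V = 0.
  rewrite map_mxB map_delta_mx mulmxBl -rowE Dc Dd.
  apply/eqP; rewrite subr_eq0; apply/eqP.
  rewrite raddf_sum mulmx_suml mulmx_sum_row; apply: eq_bigr => j _ /=.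
  by rewrite map_mxZ map_delta_mx -scalemxAl -rowE mxE row_rowsub.
move/eqP; rewrite !mxE !eqxx summxE big1 ?subr0 ?oner_eq0 // => j _.
rewrite !mxE eqxx /=; case: (i =P f j) => [ij|]; last by rewrite mulr0.
case/negP: Nif; rewrite ij.
exact: codom_f.
Qed.

(** The [Fq]-span of [p] independent elements consists of [q ^ p] roots. *)
Lemma vanishing_size p (y : 'cV[F]_p) (P : {poly F}) :
  Fq_free y -> P != 0 -> (forall c : 'rV[Fq]_p, root P ((up c *m y) 0 0)) ->
  (q ^ p < size P)%N.
Proof.
move=> freey nzP rP; pose s := [seq (up c *m y) 0 0 | c : 'rV[Fq]_p].
have <- : size s = (q ^ p)%N by rewrite size_image card_mx mul1n.
apply: max_poly_roots => //; first by apply/allP=> _ /mapP[c _ ->].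
rewrite map_inj_uniq ?enum_uniq // => c d ecd.
apply/eqP; rewrite -subr_eq0; apply/eqP/freey/rowP=> k.
rewrite map_mxB mulmxBl [k]ord1 !mxE; move: ecd; rewrite !mxE => ->.
by rewrite subrr.
Qed.

(** The case of a basis of [F], whose span is the whole field. *)
Lemma nonroot (P : {poly F}) : P != 0 -> (size P <= q ^ m)%N ->
  exists x, ~~ root P x.
Proof.
move=> nzP szP; pose y : 'cV[F]_m := \col_i tnth (vbasis {:F}) i.
have freey : Fq_free y.
  move=> c /rowP/(_ 0); rewrite !mxE => cy0.
  have /freeP/(_ (c 0)) := basis_free (vbasisP {:F}).
  move=> H; apply/rowP=> i; rewrite mxE; apply: H; rewrite -[RHS]cy0.
  apply: eq_bigr => j _; rewrite !mxE (tnth_nth 0).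
  by rewrite -scalerAl mul1r.
have [/forallP allr | /forallPn[c]] :=
    boolP [forall c : 'rV[Fq]_m, root P ((up c *m y) 0 0)].
  by have := leq_trans (vanishing_size freey nzP allr) szP; rewrite ltnn.
by exists ((up c *m y) 0 0).
Qed.

Definition qpoly n (c : nat -> F) : {poly F} := \sum_(k < n.+1) c k *: 'X^(q ^ k).

Lemma size_qpoly n c : (size (qpoly n c) <= (q ^ n).+1)%N.
Proof.
apply: (leq_trans (size_sum _ _ _)); apply/bigmax_leqP=> k _.
apply: (leq_trans (size_scale_leq _ _)).
by rewrite size_polyXn ltnS leq_pexp2l ?(ltnW order_gt1) // -ltnS.
Qed.

Lemma qpoly_neq0 n c (k : nat) : (k <= n)%N -> c k != 0 -> qpoly n c != 0.
Proof.
move=> le_kn; apply: contraNneq => P0.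
have := congr1 (coefp (q ^ k)) P0; rewrite /= coef0 coef_sum => <-.
have ltk : (k < n.+1)%N by [].
rewrite (bigD1 (Ordinal ltk)) //= coefZ coefXn eqxx mulr1 big1 ?addr0 //.
move=> j; rewrite -val_eqE /= coefZ coefXn => /negPf nkj.
by rewrite eqn_exp2l ?order_gt1 // eq_sym nkj mulr0.
Qed.

Lemma horner_qpoly n c x : (qpoly n c).[x] = \sum_(k < n.+1) c k * iter k frob x.
Proof.
rewrite horner_sum; apply: eq_bigr => k _.
by rewrite hornerZ hornerXn iter_frob.
Qed.

(** A nonzero linearized polynomial of [q]-degree [n] has degree at most
    [q ^ n], and its roots form an [Fq]-space. *)
Lemma qpoly_bound p n (c : nat -> F) (y : 'cV[F]_p) k :
  Fq_free y -> (k <= n)%N -> c k != 0 ->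
  (forall i, \sum_(k < n.+1) c k * iter k frob (y i 0) = 0) -> (p <= n)%N.
Proof.
move=> freey le_kn nzc c0.
have := vanishing_size freey (qpoly_neq0 le_kn nzc).
move=> H; have {H}/leq_trans/(_ (size_qpoly n c)) : (q ^ p < size (qpoly n c))%N.
  apply: H => d; apply/rootP; rewrite horner_qpoly.
  have -> : \sum_(k < n.+1) c k * iter k frob ((up d *m y) 0 0) =
     \sum_i (d 0 i)%:A * \sum_(k < n.+1) c k * iter k frob (y i 0).
    under [RHS]eq_bigr do rewrite mulr_sumr.
    rewrite exchange_big; apply: eq_bigr => h _ /=.
    rewrite iter_frob mxE.
    have -> : (\sum_j up d 0 j * y j 0) ^+ (q ^ h)
           = \sum_j (d 0 j)%:A * iter h frob (y j 0).
      rewrite -iter_frob; elim: (h : nat) => [|e IHe] /=.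
        by apply: eq_bigr => j _; rewrite mxE.
      rewrite IHe raddf_sum; apply: eq_bigr => j _ /=.
      by rewrite rmorphM /= frob_alg.
    by rewrite mulr_sumr; apply: eq_bigr => j _; rewrite mulrCA.
  by apply: big1 => i _; rewrite c0 mulr0.
by rewrite ltnS leq_exp2l ?order_gt1.
Qed.

Lemma qpoly_bound_seq p (c : seq F) (y : 'cV[F]_p) :
  Fq_free y -> ~~ all (pred1 0) c ->
  (forall i, \sum_(k < size c) c`_k * iter k frob (y i 0) = 0) -> (p < size c)%N.
Proof.
move=> freey /allPn[x cx /= nzx]; have := cx; rewrite -index_mem.
case Dn: (size c) => [//|n]; rewrite !ltnS => le_n.
by apply: qpoly_bound freey le_n _; rewrite nth_index.
Qed.

(** * Trace duality *)

Definition Tr (x : F) : F := \sum_(k < m) iter k frob x.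

Lemma Tr_frob x : Tr (frob x) = Tr x.
Proof.
rewrite /Tr; have := dimF_gt0; have := expr_order x; rewrite -iter_frob.
case: m => // d fx _; rewrite big_ord_recr big_ord_recl /= addrC -iterSr fx.
by congr (_ + _); apply: eq_bigr => i _; rewrite -iterSr.
Qed.

Lemma Tr_is_nmod_morphism : nmod_morphism Tr.
Proof.
have iterD k : {morph iter k frob : x y / x + y}.
  by move=> x y; elim: k => // k IHk; rewrite !iterS IHk rmorphD.
split.
  rewrite /Tr big1 // => i _.
  by elim: (i : nat) => // k IHk; rewrite iterS IHk rmorph0.
by move=> x y; rewrite /Tr -big_split; apply: eq_bigr => i _; rewrite iterD.
Qed.

HB.instance Definition _ := GRing.isNmodMorphism.Build F F Tr Tr_is_nmod_morphism.

Lemma frob_Tr x : frob (Tr x) = Tr x.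
Proof.
by rewrite -[RHS]Tr_frob /Tr raddf_sum; apply: eq_bigr => i _; rewrite -iterS iterSr.
Qed.

Lemma TrZ a x : Tr (a *: x) = a *: Tr x.
Proof.
rewrite /Tr scaler_sumr; apply: eq_bigr => i _.
elim: (i : nat) => // k IHk; rewrite !iterS IHk -mulr_algl rmorphM /= frob_alg.
by rewrite mulr_algl.
Qed.

(** The trace is a nonzero linearized polynomial of [q]-degree [m - 1], too
    small to vanish on all of [F]. *)
Lemma Tr_nondegenerate z : (forall x, Tr (x * z) = 0) -> z = 0.
Proof.
move=> Tz0; apply/eqP/negP=> /negP nz_z.
have [||x] := @nonroot (qpoly m.-1 (fun=> 1)).
- by apply: (@qpoly_neq0 _ _ 0); rewrite ?oner_eq0.
- apply: (leq_trans (size_qpoly _ _)).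
  by rewrite ltn_exp2l ?order_gt1 // prednK ?dimF_gt0.
rewrite rootE horner_qpoly prednK ?dimF_gt0 // => /eqP; apply.
rewrite -[RHS](Tz0 (x / z)) divfK //.
by apply: eq_bigr => k _; rewrite mul1r.
Qed.

(** The [c] columns of [W] impose on a row vector of [F ^ r], of dimension
    [r * m] over [Fq], only [c] linear conditions with values in [Fq].  The rows
    of [Z] are a basis of the solutions. *)
Lemma trace_annihilator r c (W : 'M[F]_(r, c)) :
  exists p (Z : 'M[F]_(p, r)),
    [/\ (r * m <= p + c)%N, Fq_free Z & map_mx Tr (Z *m W) = 0].
Proof.
have tr_ex x : {a : Fq | Tr x == a%:A}.
  by apply: sigW; have [a ->] := frob_fixed (frob_Tr x); exists a.
pose tr x := sval (tr_ex x); have trE x : Tr x = (tr x)%:A.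
  exact/eqP/(svalP (tr_ex x)).
pose f (y : {ffun 'I_r -> F}) : {ffun 'I_c -> (Fq^o : vectType Fq)} :=
  [ffun j => tr (\sum_k y k * W k j)].
have f_lin : linear f.
  move=> a x y; apply/ffunP=> j; rewrite !ffunE.
  apply: (fmorph_inj (in_alg F)); rewrite /= -trE scalerDl -!trE.
  rewrite -scalerA -trE -TrZ -raddfD; congr (Tr _).
  rewrite scaler_sumr -big_split; apply: eq_bigr => k _ /=.
  by rewrite !ffunE mulrDl scalerAl.
pose fL := GRing.isLinear.Build Fq _ _ _ f f_lin.
pose fl : {linear {ffun 'I_r -> F} -> {ffun 'I_c -> Fq^o}} := HB.pack f fL.
pose K := lker (linfun fl).
exists (\dim K), (\matrix_(i, k) tnth (vbasis K) i k); split.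
- have := limg_ker_dim (linfun fl) fullv; rewrite capfv -/K dimvf /dim /= card_ord.
  rewrite dimvf => <-; rewrite leq_add2l.
  by apply: leq_trans (dimvS (subvf _)) _; rewrite dimvf /dim /= card_ord muln1.
- move=> d d0; have /freeP/(_ (d 0)) := basis_free (vbasisP K).
  move=> H; apply/rowP=> i; rewrite mxE; apply: H; apply/ffunP=> k.
  have /rowP/(_ k) := d0; rewrite !mxE => dk0; rewrite sum_ffunE ffunE -[RHS]dk0.
  by apply: eq_bigr => j _; rewrite !ffunE !mxE (tnth_nth 0) -scalerAl mul1r.
- apply/matrixP=> i j; rewrite !mxE trE.
  have : tnth (vbasis K) i \in K by apply/vbasis_mem/mem_tnth.
  rewrite memv_ker lfunE /= => /eqP/ffunP/(_ j); rewrite !ffunE => f0.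
  under eq_bigr do rewrite mxE.
  by rewrite f0 scale0r.
Qed.

(** * Thin matrices *)

(** Equivalently, the columns of [V] span an [Fq]-space of dimension at most [c],
    that is, the support of [V] has dimension at most [c].  The factored form is
    what survives field automorphisms, changes of coordinates and products. *)
Definition thin c r n (V : 'M[F]_(r, n)) :=
  exists (W : 'M[F]_(r, c)) (N : 'M[Fq]_(c, n)), V = W *m up N.

(** Expand the entries of [V] over a basis of [F], then the rows of the expansions
    over a basis of the support. *)
Lemma thin_Rsupp r n (V : 'M[F]_(r, n)) : thin (\rank (Rsupp V)) V.
Proof.
pose e : 'rV[F]_(\dim {:F}) := \row_i tnth (vbasis {:F}) i.
have eE (x : 'rV[F]_n) : x = e *m up (expand x).
  apply/rowP=> j; rewrite {1}(coord_vbasis (memvf (x 0 j))) mxE.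
  by apply: eq_bigr => i _; rewrite !mxE (tnth_nth 0) -scalerAr mulr1.
set B := row_base (Rsupp V).
exists (\matrix_i (e *m up (expand (row i V) *m pinvmx B))), B.
apply/row_matrixP => i; rewrite row_mul rowK -mulmxA -map_mxM mulmxKpV -?eE //.
rewrite eq_row_base; have : (<<expand (row i V)>> <= Rsupp V)%MS.
  exact: (sumsmx_sup i).
by rewrite genmxE.
Qed.

End Frobenius.

(** * The hypothesis on kappa *)

Lemma CnumE q r : (1 < q)%N -> Cnum q 1 r = (\sum_(i < r) q ^ i)%N.
Proof. by move=> q1; rewrite /Cnum mul1n expn1 !subn1 predn_exp mulKn; lia. Qed.

Lemma Cnum_mul q r : (1 < q)%N -> ((q - 1) * Cnum q 1 r = q ^ r - 1)%N.
Proof. by move=> q1; rewrite CnumE // !subn1 predn_exp. Qed.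

Section Kappa.
Variables (Fq : finFieldType) (F : fieldExtType Fq) (l : nat) (A : l.-tuple F).
Local Notation q := #|Fq|.
Local Notation m := (\dim {:F}).
Local Notation up := (map_mx (in_alg F)).
Hypothesis l_gt1 : (1 < l)%N.
Hypothesis A_neq0 : forall i, tnth A i != 0.

(** Going once round the cycle expresses [b ^+ (q ^ l)] as the product of [b],
    of [lam ^+ Cnum q 1 l] and of the conjugates of the [alpha]'s; the latter
    product is [kappa A] up to the [Cnum q 1 l]-th power of [alpha A 2].  As
    [q ^ l - 1 = (q - 1) * Cnum q 1 l], this makes [kappa A] a power. *)
Lemma kappa_power_of_recurrence (b : 'I_l -> F) (lam : F) :
  (forall j, frob (b (ordS j)) = lam * (tnth A (ordS j) * b j)) ->
  (forall j, b j != 0) -> is_power (Cnum q 1 l) (kappa A).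
Proof.
move=> rec nzb.
have l_gt0 := ltnW l_gt1.
(* indices modulo l; subscript n of alpha is index n - 1 of the tuple *)
pose o (n : nat) : 'I_l := Ordinal (ltn_pmod n l_gt0).
have ordSo n : ordS (o n) = o n.+1.
  by apply: val_inj; rewrite /= -addn1 modnDml addn1.
pose a n := tnth A (o n).
have aE n : alpha A n.+1 = a n.
  by rewrite /alpha addSn /= modnDr /a (tnth_nth 0).
have o_l n : o (n + l)%N = o n by apply: val_inj; rewrite /= modnDr.
have recn n : b (o (1 + n)%N) ^+ (q ^ n) =
    lam ^+ (\sum_(i < n) q ^ i) * (\prod_(u < n) a (2 + u)%N ^+ (q ^ u)) * b (o 1).
  elim: n => [|n IHn]; first by rewrite !big_ord0 !expr1 !mul1r.
  have := rec (o (1 + n)%N); rewrite ordSo /frob => rn.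
  rewrite expnS exprM addnS rn !exprMn IHn !big_ord_recr /= exprD -/(a _).
  by ring.
(* start from index 1, where b is b_2 and the product is Pi_2 *)
have := recn l; rewrite o_l.
have Dpi : \prod_(u < l) a (2 + u)%N ^+ (q ^ u) = kappa A * a 1%N ^+ Cnum q 1 l.
  have [k Dl] : {k | l = k.+2} by exists (l - 2)%N; rewrite -addn2 subnK.
  have big_l (f : nat -> F) n : n = k.+2 ->
      \prod_(u < n) f u = (\prod_(u < k) f u) * f k * f k.+1.
    by move=> ->; rewrite !big_ord_recr.
  have CnumS n : Cnum q 1 n.+1 = (Cnum q 1 n + q ^ n)%N.
    by rewrite !CnumE ?order_gt1 // big_ord_recr.
  rewrite (big_l (fun u => a (2 + u)%N ^+ (q ^ u)) _ Dl).
  have -> : a (2 + k)%N = a 0%N by rewrite add2n -Dl -(add0n l) /a o_l.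
  have -> : a (2 + k.+1)%N = a 1%N by rewrite addnS add2n -Dl -(add1n l) /a o_l.
  have -> : Cnum q 1 l = (Cnum q 1 (l - 1) + q ^ k.+1)%N.
    by rewrite Dl subn1 CnumS.
  have -> : \prod_(u < k) a (2 + u)%N ^+ (q ^ u) =
            \prod_(3 <= u < l.+1) alpha A u ^+ (q ^ (u - 3)).
    have -> : l.+1 = (k + 3)%N by rewrite Dl addn3.
    rewrite -[3%N]add0n big_addn addnK big_mkord.
    by apply: eq_bigr => i _; rewrite addnK addn3 aE.
  rewrite /kappa !aE exprD (_ : l - 2 = k)%N; last by rewrite Dl !subSS subn0.
  by field; rewrite expf_neq0 ?A_neq0.
rewrite Dpi -CnumE ?order_gt1 // => bl.
have nzl : lam != 0.
  apply/eqP => l0; have := rec (o 0); rewrite l0 mul0r => /eqP.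
  by rewrite fmorph_eq0 (negPf (nzb _)).
exists (b (o 1) ^+ (q - 1) / (lam * a 1%N)).
  by rewrite mulf_neq0 ?expf_neq0 ?invr_eq0 ?mulf_neq0 ?A_neq0 ?nzb.
rewrite expr_div_n -exprM Cnum_mul ?order_gt1 // exprMn.
have ql : (0 < q ^ l)%N by rewrite expn_gt0 ltnW ?order_gt1.
apply: (mulfI (nzb (o 1))); rewrite [RHS]mulrA -exprS subn1 prednK // bl.
by field; rewrite !expf_neq0 ?A_neq0.
Qed.

Hypothesis kappaP : ~ is_power (Cnum q 1 l) (kappa A).

(** If all the minors vanished, no [b j] could be zero, since a nonzero [b j]
    forces a nonzero successor; the constant ratio of the two vectors would then
    be the [lam] of a recurrence that makes [kappa A] a power. *)
Lemma shift_independent (b : 'I_l -> F) j0 : b j0 != 0 ->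
  exists i j, frob (b (ordS i)) * (tnth A (ordS j) * b j)
              - frob (b (ordS j)) * (tnth A (ordS i) * b i) != 0.
Proof.
move=> nzb0.
have [/existsP[i /existsP[j Dij]] | /existsPn D0] := boolP [exists i, exists j,
   frob (b (ordS i)) * (tnth A (ordS j) * b j)
              - frob (b (ordS j)) * (tnth A (ordS i) * b i) != 0].
  by exists i, j.
have {}D0 i j : frob (b (ordS i)) * (tnth A (ordS j) * b j)
              = frob (b (ordS j)) * (tnth A (ordS i) * b i).
  by have /existsPn/(_ j) := D0 i; rewrite negbK subr_eq0 => /eqP.
have step j : b j != 0 -> b (ordS j) != 0.
  move=> nzj; have := D0 (ord_pred j) j; rewrite ord_predK => e.
  have : frob (b j) * (tnth A (ordS j) * b j) != 0.
    by rewrite !mulf_neq0 ?fmorph_eq0.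
  by rewrite e mulf_eq0 fmorph_eq0 negb_or => /andP[].
have nzb j : b j != 0.
  have iterb n : b (iter n (@ordS l) j0) != 0 by elim: n => //= n; apply: step.
  have vi n : val (iter n (@ordS l) j0) = ((j0 + n) %% l)%N.
    elim: n => [|n IHn]; first by rewrite addn0 modn_small.
    by rewrite iterS [LHS]/= [nat_of_ord _]IHn -addn1 modnDml addn1 addnS.
  have := iterb (l - j0 + j)%N; congr (b _ != 0); apply: val_inj.
  by rewrite vi addnA subnKC ?(ltnW (ltn_ord j0)) // modnDl modn_small.
case: kappaP; pose r := tnth A (ordS j0) * b j0.
have nzr : r != 0 by rewrite mulf_neq0.
apply: (@kappa_power_of_recurrence b (frob (b (ordS j0)) / r)) => // j.
by apply: (mulIf nzr); rewrite D0 mulrAC divfK.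
Qed.

(** * Equations for the annihilator *)

Lemma graphAl x i : graphA A x (lshift l i) = x i.
Proof. by rewrite ffunE (unsplitK (inl i)). Qed.

Lemma graphAr x i : graphA A x (rshift l i) = fA A x i.
Proof. by rewrite ffunE (unsplitK (inr i)). Qed.

Definition graph_col (x : {ffun 'I_l -> F}) : 'cV[F]_(l + l) :=
  \col_i graphA A x i.

(** Column [j] collects the coefficients of [x (j + 1) ^+ (q ^ 2)] in
    [Y *m graph_col x]. *)
Definition twist r (Y : 'M[F]_(r, l + l)) : 'M[F]_(r, l) :=
  \matrix_(k, j) (tnth A (ordS j) * Y k (rshift l j)).

(** The adjoint of [t |-> a * t + b * t ^+ q + c * t ^+ (q ^ 2)] for the trace
    form, raised to the power [q ^ 2] to clear the roots: [Tr] is invariant under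
    Frobenius, so each term can be written as a multiple of [t ^+ (q ^ 2)], and
    nondegeneracy lets the common factor be removed.  Column [j] comes from the
    vectors [x] supported at [j + 1]. *)
Lemma annihilator_equations r p (Z : 'M[F]_(p, r)) (Y : 'M[F]_(r, l + l)) :
  (forall x, map_mx (@Tr _ F) (Z *m (Y *m graph_col x)) = 0) ->
  map_mx (@frob _ F) (map_mx (@frob _ F) (Z *m colsub (@ordS l) (lsubmx Y)))
  + map_mx (@frob _ F) (Z *m colsub (@ordS l) (rsubmx Y)) + Z *m twist Y = 0.
Proof.
move=> TZ; apply/matrixP=> i j; rewrite [RHS]mxE.
apply: Tr_nondegenerate => x.
have [x1 ->] := frob_surj x; have [t ->] := frob_surj x1.
have /matrixP/(_ i 0) := TZ [ffun i => if i == ordS j then t else 0].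
rewrite [RHS]mxE mxE mulmxA mxE big_split_ord /=.
set S1 := \sum_(_ < _) _; set S2 := \sum_(_ < _) _.
have -> : S1 = (Z *m colsub (@ordS l) (lsubmx Y)) i j * t.
  rewrite /S1 (bigD1 (ordS j)) //= big1 => [|k /negPf njk].
    rewrite addr0 [X in _ * X]mxE graphAl ffunE eqxx; congr (_ * _).
    by rewrite !mxE; apply: eq_bigr => k _; rewrite !mxE.
  by rewrite [X in _ * X]mxE graphAl ffunE njk mulr0.
have -> : S2 = (Z *m colsub (@ordS l) (rsubmx Y)) i j * frob t
              + (Z *m twist Y) i j * frob (frob t).
  rewrite /S2; under eq_bigr => k _.
    rewrite [X in _ * X]mxE graphAr /fA !ffunE mulrDr.
    over.
  rewrite big_split /=; congr (_ + _).
    rewrite (bigD1 (ordS j)) //= eqxx big1 => [|k /negPf njk].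
      rewrite addr0; congr (_ * _).
      by rewrite !mxE; apply: eq_bigr => k _; rewrite !mxE.
    by rewrite njk expr0n -[q]prednK ?mulr0 // (ltnW (order_gt1 _)).
  rewrite (bigD1 j) //= eqxx big1 => [|k /negPf njk].
    rewrite addr0 -iter_frob /= mulrA; congr (_ * _); rewrite !mxE mulr_suml.
    by apply: eq_bigr => k _; rewrite !mxE; ring.
  rewrite (inj_eq (@ordS_inj l)) njk expr0n -[(q ^ 2)%N]prednK ?mulr0 //.
  by rewrite expn_gt0 (ltnW (order_gt1 _)).
move: (Z *m colsub _ (lsubmx Y)) (Z *m colsub _ (rsubmx Y)) (Z *m twist Y).
move=> U V W; rewrite !raddfD /= !mxE => <-.
rewrite -(Tr_frob (U i j * t)) -(Tr_frob (frob (U i j * t))) -(Tr_frob (V i j * _)).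
by rewrite -!raddfD /= !rmorphM /=; congr (Tr _); ring.
Qed.

(** * Bounds on the solution spaces *)

Lemma Fq_free_frob p n (V : 'M[F]_(p, n)) :
  Fq_free V -> Fq_free (map_mx (@frob _ F) V).
Proof.
move=> freeV c; rewrite -map_frob_up -map_mxM => /eqP; rewrite map_mx_eq0.
by move/eqP/freeV.
Qed.

(** By [shift_independent], two of the equations can be combined so as to
    eliminate [y] and to keep a nonzero multiple of [y ^+ q]: what remains is an
    equation of order one for [y ^+ q]. *)
Lemma solutions_le1 p (a b : 'I_l -> F) (y : 'cV[F]_p) :
  (exists j, (a j != 0) || (b j != 0)) -> Fq_free y ->
  (forall i j, frob (frob (y i 0 * a (ordS j))) + frob (y i 0 * b (ordS j))
            + y i 0 * (tnth A (ordS j) * b j) = 0) -> (p <= 1)%N.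
Proof.
move=> nzab freey eqs.
have [/forallP b0 | /forallPn[j0 nzb]] := boolP [forall j, b j == 0].
  have [j /orP[|]] := nzab; last by rewrite b0.
  move=> nza; apply: (@leq_trans 0) => //.
  apply: (@qpoly_bound _ _ _ 0 (fun=> 1) y 0 freey); rewrite ?oner_eq0 //.
  move=> i; rewrite big_ord1 mul1r /=; apply/eqP.
  have := eqs i (ord_pred j); rewrite ord_predK (eqP (b0 j)) (eqP (b0 _)).
  rewrite !mulr0 rmorph0 !addr0 => /eqP; rewrite !fmorph_eq0 mulf_eq0.
  by rewrite (negPf nza) orbF.
have [i0 [j1 D]] := shift_independent nzb.
pose c k := [:: frob (b (ordS i0)) * (tnth A (ordS j1) * b j1)
              - frob (b (ordS j1)) * (tnth A (ordS i0) * b i0);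
       tnth A (ordS j1) * b j1 * frob (frob (a (ordS i0)))
       - tnth A (ordS i0) * b i0 * frob (frob (a (ordS j1)))]`_k.
apply: (qpoly_bound (c := c) (k := 0) (Fq_free_frob freey)) => // i.
rewrite !big_ord_recr big_ord0 /= add0r /c /= mxE.
have := eqs i i0; have := eqs i j1; rewrite !rmorphM /=.
set y1 := frob (y i 0); set y2 := frob y1; move=> e1 e2.
transitivity (tnth A (ordS j1) * b j1 * 0 - tnth A (ordS i0) * b i0 * 0); last by ring.
by rewrite -{1}e2 -e1; ring.
Qed.

(** Two unknowns [y] and [z], the word with coefficient [z] having no part in
    the coordinates [x].  By [shift_independent] for [b'], two equations
    determine [z] and [z ^+ q] as combinations of [y], [y ^+ q] and
    [y ^+ (q ^ 2)]; comparing the Frobenius of the first expression with the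
    second gives an equation of order three for [y].  If it is trivial, [z] only involves [y] and [y ^+ q], and
    substituting it everywhere gives equations of order two for [y].  If those
    are trivial too, [a] is zero and [b] is a multiple of [b'], which is
    excluded. *)
Lemma solutions_le3 p (a b b' : 'I_l -> F) (y z : 'cV[F]_p) :
  (exists j, b' j != 0) ->
  ~ ((forall j, a j = 0) /\ exists c, forall j, b j = c * b' j) ->
  Fq_free (row_mx y z) ->
  (forall i j, frob (frob (y i 0 * a (ordS j)))
            + frob (y i 0 * b (ordS j)) + frob (z i 0 * b' (ordS j))
            + y i 0 * (tnth A (ordS j) * b j)
            + z i 0 * (tnth A (ordS j) * b' j) = 0) -> (p <= 3)%N.
Proof.
move=> [j0 nzb'] nzab freeyz eqs.
have [i1 [j1]] := shift_independent nzb'.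
pose R j := tnth A (ordS j) * b' j; pose P j := frob (b' (ordS j)).
pose r j := tnth A (ordS j) * b j; pose s j := frob (b (ordS j)).
pose a2 j := frob (frob (a (ordS j))).
rewrite -/(R _) -/(R _) -/(P _) -/(P _); set D := _ - _ => nzD.
pose y1 i := frob (y i 0); pose y2 i := frob (y1 i).
pose det (S f : 'I_l -> F) := (S i1 * f j1 - S j1 * f i1) / D.
have {}eqs i j : a2 j * y2 i + s j * y1 i + r j * y i 0
     + P j * frob (z i 0) + R j * z i 0 = 0.
  by rewrite -[RHS](eqs i j) !rmorphM /=  /a2 /y2 /y1 /s /r /P /R; ring.
have zE i : z i 0 = - (det P a2 * y2 i + det P s * y1 i + det P r * y i 0).
  apply: (mulfI nzD); apply/eqP; rewrite -subr_eq0; apply/eqP.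
  transitivity (P i1 * 0 - P j1 * 0); last by ring.
  by rewrite -{1}(eqs i j1) -(eqs i i1) /det /D; field.
have z1E i : frob (z i 0) = det R a2 * y2 i + det R s * y1 i + det R r * y i 0.
  apply: (mulfI nzD); apply/eqP; rewrite -subr_eq0; apply/eqP.
  transitivity (R j1 * 0 - R i1 * 0); last by ring.
  by rewrite -{1}(eqs i i1) -(eqs i j1) /det /D; field.
(* z is a function of y, so nothing is lost by forgetting z *)
have freey : Fq_free y.
  move=> c cy; apply: freeyz; rewrite mul_mx_row cy.
  suff -> : up c *m z = 0 by rewrite row_mx0.
  have -> : z = - (det P a2 *: map_mx (@frob _ F) (map_mx (@frob _ F) y)
      + det P s *: map_mx (@frob _ F) y + det P r *: y).
    by apply/colP=> i; rewrite zE !mxE.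
  rewrite mulmxN !mulmxDr -!scalemxAr cy -{1}map_frob_up -{1}map_frob_up.
  rewrite -!map_mxM cy -{1}map_frob_up -map_mxM cy !map_mx0 !scaler0.
  by rewrite !addr0 oppr0.
move: (det P a2) (det P s) (det P r) (det R a2) (det R s) (det R r) zE z1E.
move=> al be ga al' be' ga' zE z1E.
pose c3 := [:: ga'; be' + frob ga; al' + frob be; frob al].
have [c30 | nz3] := boolP (all (pred1 0) c3); last first.
  apply: (qpoly_bound_seq freey nz3) => i.
  rewrite !big_ord_recl big_ord0 /= -/(y1 i) -/(y2 i).
  have := congr1 (@frob _ F) (zE i); rewrite z1E rmorphN !rmorphD !rmorphM /=.
  rewrite -/(y2 i) -/(y1 i) => e.
  transitivity (al' * y2 i + be' * y1 i + ga' * y i 0 + (frob al * frob (y2 i)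
    + frob be * y2 i + frob ga * y1 i)); first by ring.
  by rewrite e addNr.
have P0 : al = 0.
  by case/and5P: c30 => _ _ _ /=; rewrite fmorph_eq0 => /eqP.
pose c2 j := [:: r j - R j * ga; s j - P j * frob ga - R j * be;
               a2 j - P j * frob be].
have [/forallP c20 | /forallPn[j nz2]] := boolP [forall j, all (pred1 0) (c2 j)];
    last first.
  apply: leq_trans (_ : 2 <= 3)%N => //.
  apply: (qpoly_bound_seq freey nz2) => i.
  rewrite !big_ord_recl big_ord0 /= -/(y1 i) -/(y2 i).
  have := eqs i j; rewrite zE P0 mul0r add0r rmorphN !rmorphD !rmorphM /=.
  by rewrite -/(y2 i) -/(y1 i) => e; rewrite -[RHS]e; ring.
have {}c20 j : [/\ r j = R j * ga,
    s j = P j * frob ga + R j * be & a2 j = P j * frob be].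
  have /and4P[/eqP r0 /eqP t0 /eqP e0 _] := c20 j.
  by split; apply/eqP; rewrite -subr_eq0 ?opprD ?addrA ?r0 ?t0 ?e0.
have bE j : b j = ga * b' j.
  have [rj _ _] := c20 j; apply: (mulfI (A_neq0 (ordS j))).
  by rewrite -/(r j) rj /R; ring.
have Ps0 : be = 0.
  have [_ sj _] := c20 j0; move/eqP: sj.
  rewrite /s bE rmorphM mulrC -/(P j0) addrC -subr_eq subrr eq_sym.
  by rewrite !mulf_eq0 (negPf (A_neq0 _)) (negPf nzb') /= => /eqP.
case: nzab; split; last by exists ga.
move=> j; have [_ _ /eqP] := c20 (ord_pred j).
by rewrite Ps0 rmorph0 mulr0 !fmorph_eq0 ord_predK => /eqP.
Qed.

(** If the coefficients of the leading terms are independent, the system can be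
    solved for [Z ^ (q ^ 2)]; it is then of order one in the [2 * r] unknowns
    [Z] and [Z ^ q], its matrix being the companion matrix. *)
Lemma solutions_le_double r p (Z : 'M[F]_(p, r)) (Y : 'M[F]_(r, l + l)) :
  row_free (lsubmx Y) -> Fq_free Z ->
  map_mx (@frob _ F) (map_mx (@frob _ F) (Z *m colsub (@ordS l) (lsubmx Y)))
  + map_mx (@frob _ F) (Z *m colsub (@ordS l) (rsubmx Y)) + Z *m twist Y = 0 ->
  (p <= r + r)%N.
Proof.
case/row_freeP=> X0 YX freeZ.
pose ff n k (M : 'M[F]_(n, k)) := map_mx (@frob _ F) (map_mx (@frob _ F) M).
pose X := ff _ _ (rowsub (@ordS l) X0).
have YX1 : ff _ _ (colsub (@ordS l) (lsubmx Y)) *m X = 1%:M.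
  rewrite /X /ff -!map_mxM; suff -> : colsub (@ordS l) (lsubmx Y) *m
    rowsub (@ordS l) X0 = 1%:M by rewrite !map_mx1.
  rewrite -YX; apply/matrixP=> i j; rewrite !mxE.
  rewrite [RHS](reindex (@ordS l)) /=; last exact/onW_bij/ordS_bij.
  by apply: eq_bigr => k _; rewrite !mxE.
move=> eqZ.
pose B := map_mx (@frob _ F) (colsub (@ordS l) (rsubmx Y)).
pose V := row_mx Z (map_mx (@frob _ F) Z).
apply: (@Fq_free_rank _ _ _ _ V (block_mx 0 (- (twist Y *m X)) 1%:M (- (B *m X)))).
  by move=> c; rewrite mul_mx_row -row_mx0 => /eq_row_mx[/freeZ].
rewrite /V mul_row_block map_row_mx mulmx0 add0r mulmx1; congr row_mx.
have := congr1 (mulmx^~ X) eqZ; rewrite !mul0mx !mulmxDl !map_mxM -mulmxA.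
rewrite YX1 mulmx1 -!mulmxA !mulmxN => /eqP.
by rewrite -addrA addr_eq0 opprD addrC => /eqP.
Qed.

(** * Supports of words and planes *)

Section Supports.
Variables (n : nat) (H : 'M[F]_(l + l, n)).
Hypothesis H_graph : forall x, exists d : 'cV[Fq]_n, graph_col x = H *m up d.

Lemma thin_annihilator r c (Y : 'M[F]_(r, l + l)) : thin c (Y *m H) ->
  exists p (Z : 'M[F]_(p, r)), [/\ (r * m <= p + c)%N, Fq_free Z &
  map_mx (@frob _ F) (map_mx (@frob _ F) (Z *m colsub (@ordS l) (lsubmx Y)))
  + map_mx (@frob _ F) (Z *m colsub (@ordS l) (rsubmx Y)) + Z *m twist Y = 0].
Proof.
case=> W [N YH]; have [p [Z [lep freeZ TZ]]] := trace_annihilator W.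
exists p, Z; split=> //; apply: annihilator_equations => x.
have [d ->] := H_graph x; rewrite (mulmxA Y) YH -mulmxA -map_mxM mulmxA.
move: (Z *m W) (N *m d) TZ => V {}d TV.
apply/matrixP=> i j; rewrite !mxE raddf_sum big1 // => k _.
have /matrixP/(_ i k) := TV; rewrite !mxE => Tik.
by rewrite -scalerAr mulr1 /= TrZ Tik scaler0.
Qed.

Lemma word_support_ge c (Y : 'rV[F]_(l + l)) :
  Y != 0 -> thin c (Y *m H) -> (m - 1 <= c)%N.
Proof.
move=> nzY /thin_annihilator[p [Z [lep freeZ eqZ]]].
suff: (p <= 1)%N by lia.
apply: (@solutions_le1 p (fun j => Y 0 (lshift l j)) (fun j => Y 0 (rshift l j)) Z)
  => //.
  have /rV0Pn[k] := nzY; rewrite -(splitK k); case: (split k) => j /= nzj.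
    by exists j; rewrite nzj.
  by exists j; rewrite nzj orbT.
move=> i j; have /matrixP/(_ i j) := eqZ.
by rewrite !mxE !big_ord1 !mxE.
Qed.

Lemma unit_with_first_row r (u : 'rV[F]_r.+1) : u != 0 ->
  exists2 g : 'M[F]_r.+1, g \in unitmx & exists2 c, c != 0 & u = c *: row 0 g.
Proof.
move=> nzu; exists (row_ebase u); first exact: row_ebase_unit.
exists (col_ebase u 0 0).
  by have := col_ebase_unit u; rewrite unitmxE det_mx11 unitfE.
rewrite -[LHS]mulmx_ebase (_ : \rank u = 1%N); last by rewrite rank_rV nzu.
rewrite rowE [col_ebase u]mx11_scalar mul_scalar_mx mxE eqxx -scalemxAl.
congr (_ *: (_ *m _)).
by apply/rowP=> j; rewrite !mxE !eqxx /= andbT; case: j => [[|j] ?].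
Qed.

(** The annihilator of a plane has dimension at most four.  When the parts of the
    two words in the coordinates [x] are dependent, a change of basis makes one
    of them zero, and the bound is even three. *)
Lemma plane_support_ge c (Y : 'M[F]_(2, l + l)) :
  row_free Y -> thin c (Y *m H) -> (2 * m - 4 <= c)%N.
Proof.
move=> freeY YH.
have [freeYa | ] := boolP (row_free (lsubmx Y)).
  have [p [Z [lep freeZ eqZ]]] := thin_annihilator YH.
  by have := solutions_le_double freeYa freeZ eqZ; lia.
rewrite -kermx_eq0 => /rowV0Pn[u /sub_kermxP uY nzu].
have [g gU [d nzd Du]] := unit_with_first_row nzu.
pose Y1 := g *m Y.
have freeY1 : row_free Y1 by rewrite /row_free mxrankMfree // mxrank_unit.
have Y1H : thin c (Y1 *m H).
  by case: YH => W [N DYH]; exists (g *m W), N; rewrite -!mulmxA DYH.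
have Y10 j : Y1 0 (lshift l j) = 0.
  have : row 0 g *m lsubmx Y = 0.
    by apply: (scalerI nzd); rewrite scalemxAl -Du uY scaler0.
  by rewrite -row_mul mulmx_lsub => /rowP/(_ j); rewrite !mxE.
clearbody Y1.
have [p [Z [lep freeZ eqZ]]] := thin_annihilator Y1H.
suff: (p <= 3)%N by lia.
apply: (@solutions_le3 p (fun j => Y1 1 (lshift l j)) (fun j => Y1 1 (rshift l j))
   (fun j => Y1 0 (rshift l j)) (col 1 Z) (col 0 Z)).
- have : row 0 Y1 != 0.
    apply/eqP=> Y0; have : delta_mx 0 0 *m Y1 = 0 :> 'rV_ _ by rewrite -rowE.
    move/(canRL (mulmxKp freeY1))/rowP/(_ 0); rewrite mul0mx !mxE /=.
    by move/eqP; rewrite oner_eq0.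
  case/rV0Pn=> k; rewrite mxE -(splitK k); case: (split k) => j /= nzj.
    by rewrite Y10 eqxx in nzj.
  by exists j.
- case=> a0 [e be]; pose v : 'rV[F]_2 := delta_mx 0 1 - e *: delta_mx 0 0.
  have : v *m Y1 = 0.
    rewrite mulmxBl -scalemxAl -!rowE; apply/rowP=> k; rewrite !mxE.
    rewrite -(splitK k); case: (split k) => j /=.
      by rewrite a0 Y10 mulr0 subr0.
    by rewrite be subrr.
  move/(canRL (mulmxKp freeY1))/rowP/(_ 1); rewrite mul0mx !mxE /=.
  by move/eqP; rewrite mulr0 subr0 oner_eq0.
- move=> v; rewrite mul_mx_row -row_mx0 => /eq_row_mx[v1 v0]; apply: freeZ.
  apply/rowP=> k; rewrite [RHS]mxE.
  have {v1}/rowP/(_ 0) := v1; have {v0}/rowP/(_ 0) := v0.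
  rewrite !mxE => e0 e1.
  case: k => [[|[|//]] ltk].
    rewrite -[RHS]e0; apply: eq_bigr => k _; rewrite !mxE.
    by congr (_ * Z _ _); apply: val_inj.
  rewrite -[RHS]e1; apply: eq_bigr => k _; rewrite !mxE.
  by congr (_ * Z _ _); apply: val_inj.
move=> i j; have /matrixP/(_ i j) := eqZ.
rewrite !mxE !big_ord_recl !big_ord0 !mxE.
rewrite (_ : lift ord0 ord0 = 1); last exact: val_inj.
rewrite !Y10 !mulr0 !add0r !addr0 => <-.
by rewrite rmorphD /=; ring.
Qed.

End Supports.
End Kappa.

(** * Codes and their duals *)

Section Codes.
Variables (Fq : finFieldType) (F : fieldExtType Fq).
Local Notation up := (map_mx (in_alg F)).

Lemma row_of_lincomb k p (c : 'I_p -> Fq) (u : 'I_p -> {ffun 'I_k -> F}) :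
  row_of (\sum_i c i *: u i) = \sum_i (c i)%:A *: row_of (u i).
Proof.
apply/rowP=> j; rewrite mxE sum_ffunE summxE; apply: eq_bigr => i _.
by rewrite !mxE ffunE mulr_algl.
Qed.

Lemma row_of_inj k : injective (@row_of Fq F k).
Proof. by move=> x y /rowP e; apply/ffunP=> i; have := e i; rewrite !mxE. Qed.

Lemma mem_span_cols k n (G : 'M[F]_(k, n)) x :
  x \in <<cols G>>%VS -> exists d : 'rV[Fq]_n, row_of x = up d *m G^T.
Proof.
move/coord_span => Dx; exists (\row_j coord (cols G) j x).
rewrite {1}Dx row_of_lincomb mulmx_sum_row; apply: eq_bigr => j _.
rewrite !mxE; congr (_ *: _); apply/rowP=> i.
by rewrite !mxE -tnth_nth tnth_mktuple ffunE.
Qed.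

Lemma free_cols k n (G : 'M[F]_(k, n)) :
  (forall d : 'rV[Fq]_n, up d *m G^T = 0 -> d = 0) -> free (cols G).
Proof.
move=> inj; apply/freeP=> c c0 j.
suff /inj/rowP/(_ j) : up (\row_j c j) *m G^T = 0 by rewrite !mxE.
have <- : row_of (0 : {ffun 'I_k -> F}) = 0 by apply/rowP=> i; rewrite !mxE ffunE.
rewrite -{}c0 row_of_lincomb mulmx_sum_row; apply: eq_bigr => i _.
rewrite !mxE; congr (_ *: _); apply/rowP=> h.
by rewrite !mxE -tnth_nth tnth_mktuple ffunE.
Qed.

Lemma row_of_Fspan k (U : {vspace {ffun 'I_k -> F}}) x :
  x \in U -> (row_of x <= Fspan U)%MS.
Proof.
move/coord_vbasis->; rewrite row_of_lincomb; apply: summx_sub => i _.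
apply: scalemx_sub; rewrite -tnth_nth; apply: (eq_row_sub i).
by rewrite rowK.
Qed.

Lemma free_family (vT : vectType Fq) (S : {vspace vT}) c : (c <= \dim S)%N ->
  exists2 e : 'I_c -> vT, (forall a, e a \in S) &
    forall k : 'I_c -> Fq, \sum_a k a *: e a = 0 -> forall a, k a = 0.
Proof.
move=> lec; exists (fun a => (vbasis S)`_a).
  by move=> a; apply/vbasis_mem/mem_nth; rewrite size_tuple (leq_trans _ lec).
move=> k k0 a.
pose k' (i : nat) := oapp k 0 (insub i : option 'I_c).
have k'E (b : 'I_c) : k' b = k b by rewrite /k' valK.
have /freeP/(_ (fun i => k' i)) := basis_free (vbasisP S).
move=> H; have {}H : forall i : 'I_(\dim S), k' i = 0.
  apply: H; rewrite -[RHS]k0.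
  rewrite (eq_bigr (fun a : 'I_c => k' a *: (vbasis S)`_a)); last first.
    by move=> b _; rewrite k'E.
  rewrite (big_ord_widen _ (fun i => k' i *: (vbasis S)`_i) lec) [RHS]big_mkcond.
  apply: eq_bigr => i _ /=; case: ifP => // /negbT nlt.
  by rewrite /k' insubN //= scale0r.
by rewrite -k'E; apply: (H (widen_ord lec a)).
Qed.

Section Dual.
Variables (r n k d : nat) (H : 'M[F]_(r, n)) (G : 'M[F]_(k, n)).
Hypothesis weightH : forall c (Y : 'rV[F]_r), Y != 0 -> thin c (Y *m H) -> (d <= c)%N.
Hypothesis d_gt1 : (1 < d)%N.
Hypothesis genG : generator_matrix G (dual_code H).

Lemma weight_row_free : row_free H.
Proof.
rewrite -kermx_eq0; apply/rowV0P=> v /sub_kermxP v0; apply/eqP/negP=> /negP nzv.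
suff : (d <= 0)%N by lia.
by apply: (weightH nzv); rewrite v0; exists 0, 0; rewrite mul0mx.
Qed.

Lemma generator_dim : k = (n - r)%N.
Proof.
case: genG => /eqP fG /eqmxP eG; rewrite -fG eG mxrank_ker mxrank_tr.
by rewrite (eqP weight_row_free).
Qed.

Lemma r_leq_n : (r <= n)%N.
Proof. by rewrite -(eqP weight_row_free) rank_leq_col. Qed.

Lemma dual_dual : (dual_code G == H)%MS.
Proof.
rewrite andbC -(mxrank_leqif_eq _).
  case: genG => /eqP fG _; rewrite mxrank_ker mxrank_tr fG generator_dim.
  by rewrite (eqP weight_row_free) subKn ?r_leq_n.
apply/sub_kermxP/trmx_inj; rewrite trmx_mul trmxK trmx0; apply/sub_kermxP.
by case: genG => _ /andP[].
Qed.

Lemma dual_weight c (x : 'rV[F]_n) : x *m G^T = 0 -> x != 0 -> thin c x ->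
  (d <= c)%N.
Proof.
move/sub_kermxP; have /andP[sDH _] := dual_dual => /submx_trans/(_ sDH).
case/submxP=> Y -> nzx; apply: weightH; apply: contraNneq nzx => ->.
by rewrite mul0mx.
Qed.

(** A relation over [Fq] between the columns is a dual word of weight one. *)
Lemma dual_cols_free : free (cols G).
Proof.
apply: free_cols => x xG; apply/eqP/negP => /negP nzx.
suff : (d <= 1)%N by lia.
apply: (dual_weight xG); first by rewrite map_mx_eq0.
by exists 1%:M, x; rewrite mul1mx.
Qed.

Lemma dual_q_system : q_system n <<cols G>>%VS.
Proof.
split; first by have := dual_cols_free; rewrite /free size_tuple => /eqP.
rewrite -col_leq_rank; case: genG => /eqP fG _.
rewrite -{1}fG -mxrank_tr; apply: mxrankS; apply/row_subP => j.
have -> : row j G^T = row_of (tnth (cols G) j).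
  by apply/rowP=> i; rewrite !mxE tnth_mktuple ffunE.
by apply/row_of_Fspan/memv_span/mem_tnth.
Qed.

(** If the system met an [h]-dimensional [F]-subspace in [h.+1] independent
    vectors, these would satisfy a nontrivial [F]-linear relation; read on the
    columns of [G], it is a nonzero dual word of weight at most [h.+1]. *)
Lemma dual_scattered h : (h + 2 <= d)%N -> scattered h <<cols G>>%VS.
Proof.
move=> led P rP; rewrite leqNgt; apply/negP=> /free_family[e eS free_e].
have eU a : exists c : 'rV[Fq]_n, row_of (e a) == up c *m G^T.
  have /mem_span_cols[c ec] : e a \in <<cols G>>%VS.
    by have := eS a; rewrite memv_cap => /andP[].
  by exists c; apply/eqP.
pose N : 'M[Fq]_(h.+1, n) := \matrix_a xchoose (eU a).
have rowN a : row_of (e a) = row a (up N *m G^T).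
  by rewrite row_mul -map_row rowK; apply/eqP/(xchooseP (eU a)).
have freeN : row_free N.
  rewrite -kermx_eq0; apply/rowV0P=> v /sub_kermxP v0; apply/rowP=> a.
  rewrite mxE; apply: (free_e (v 0)); apply: row_of_inj.
  rewrite row_of_lincomb; have <- : up v *m (up N *m G^T) = row_of 0.
    rewrite mulmxA -map_mxM v0 map_mx0 mul0mx.
    by apply/rowP=> i; rewrite !mxE ffunE.
  by rewrite mulmx_sum_row; apply: eq_bigr => b _; rewrite rowN mxE.
have /rowV0Pn[w /sub_kermxP w0 nzw] : kermx (up N *m G^T) != 0.
  rewrite kermx_eq0 -row_leq_rank -ltnNge ltnS -[X in (_ <= X)%N]rP; apply: mxrankS.
  apply/row_subP => a; rewrite -rowN -mem_restrict.
  by have := eS a; rewrite memv_cap => /andP[].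
have nzwN : w *m up N != 0.
  have := row_free_map (in_alg F) N; rewrite freeN => /row_free_inj inj.
  by rewrite -(mul0mx _ (up N)) (inj_eq (inj 1)).
suff : (d <= h.+1)%N by lia.
by apply: (dual_weight _ nzwN); [rewrite -mulmxA | exists w, N].
Qed.

End Dual.

(** * The second generalized weight and equivalence *)

(** Over the finite field [F], seen as a finite type, a minimum is attained. *)
Lemma d2_exists n r (D : 'M[F]_(r, n)) : (2 <= \rank D)%N -> exists d, has_d2 D d.
Proof.
move=> rD; pose FF := finvect_type F.
pose P (V : 'M[FF]_(2, n)) :=
  row_free (V : 'M[F]_(2, n)) && ((V : 'M[F]_(2, n)) <= D)%MS.
pose f (V : 'M[FF]_(2, n)) := \rank (@Rsupp _ F _ _ (V : 'M[F]_(2, n))).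
have [V0 V0P] : exists V0, P V0.
  exists ((pid_mx 2 : 'M_(2, \rank D)) *m row_base D); apply/andP; split.
    by rewrite /row_free mxrankMfree ?row_base_free // rank_pid_mx.
  by apply: submx_trans (submxMl _ _) _; rewrite eq_row_base.
case: (@arg_minnP _ V0 P f V0P) => V VP minV.
exists (f V); split; first by exists V.
by move=> V' fV' sV'; apply: minV; rewrite /P fV'.
Qed.

(** Equivalent codes have subcodes of equally small support.  An automorphism
    of [F] permutes the fixed field of Frobenius, so its inverse turns the
    factor over [Fq] of a thin matrix into another matrix over [Fq]. *)
Lemma equiv_thin r r' n p c (C : 'M[F]_(r, n)) (C' : 'M[F]_(r', n)) (V' : 'M[F]_(p, n)) :
  code_equiv C C' -> row_free V' -> (V' <= C')%MS -> thin c V' ->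
  exists V : 'M[F]_(p, n), [/\ row_free V, (V <= C)%MS & thin c V].
Proof.
case=> sg [M [[tau sgK tauK] uM /andP[sCC _]]] fV' sV' [W [N DV']].
have /submxP[X DX] := submx_trans sV' sCC.
have tau_alg (a : Fq) : exists b : Fq, tau a%:A == b%:A.
  have : frob (tau a%:A) = tau a%:A.
    apply: (can_inj sgK); rewrite /frob rmorphXn /= tauK.
    exact: (frob_alg F a).
  by case/frob_fixed=> b ->; exists b.
pose N1 := map_mx (fun a => xchoose (tau_alg a)) (N *m invmx M).
have sgN1 : map_mx sg (up N1) = up (N *m invmx M).
  apply/matrixP=> i j; rewrite 3!mxE [in RHS]mxE.
  transitivity (sg (tau ((N *m invmx M) i j)%:A)); last by rewrite tauK.
  by congr (sg _); apply/esym/eqP/(xchooseP (tau_alg _)).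
have sgtau a b (Q : 'M[F]_(a, b)) : map_mx sg (map_mx tau Q) = Q.
  by apply/matrixP=> i j; rewrite !mxE tauK.
have uupM : up M \in unitmx by rewrite map_unitmx.
have DV : map_mx tau X *m C = map_mx tau W *m up N1.
  apply: (@map_mx_inj _ _ sg); rewrite !map_mxM /= !sgtau sgN1.
  by rewrite map_mxM map_invmx mulmxA -DV' DX -!mulmxA mulmxV // mulmx1.
exists (map_mx tau X *m C); split; last by exists (map_mx tau W), N1.
  rewrite -(row_free_map sg) map_mxM sgtau.
  move: fV'; rewrite DX /row_free mulmxA mxrankMfree //.
  by rewrite row_free_unit.
exact: submxMl.
Qed.

(** A summand is a plane supported on its own block of coordinates. *)
Lemma direct_sum_thin l (s : 'I_l -> nat) r n (C : 'M[F]_(r, n)) (i : 'I_l) :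
  order_one_direct_sum s C ->
  exists V : 'M[F]_(2, n),
    [/\ row_free V, (V <= C)%MS & thin (\dim {:F} + s i) V].
Proof.
case=> D [e [Dprop eC]]; case: n / e C eC => C; rewrite castmx_id => eC.
pose B := \mxblock_(i, j) (if i == j then D j else 0).
exists (submxcol B i); have rowB : submxcol B i = \mxrow_j (if i == j then D j else 0).
  exact: submxcol_matrix.
have [fDi _ _] := Dprop i; split.
- rewrite -kermx_eq0; apply/rowV0P=> v /sub_kermxP v0.
  have : v *m submxrow (submxcol B i) i = 0 by rewrite mul_submxrow v0 submxrow0.
  rewrite rowB mxrowK eqxx -[RHS](mul0mx _ (D i)).
  exact: (row_free_inj fDi).
- have /andP[_] := eC; apply: submx_trans; apply/row_subP => a.
  by rewrite row_rowsub row_sub.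
exists (D i), (submxcol 1%:M i); apply/mxrowP=> j.
rewrite rowB mxrowK -mul_submxrow.
have [<-|nij] := eqVneq i j.
  rewrite -[LHS]mulmx1; congr (_ *m _); apply/matrixP=> a b.
  rewrite !mxE rmorph_nat; congr ((nat_of_bool _)%:R); apply/eqP/eqP=> [->//|].
  move/(congr1 (@tagnat.sig _ _)); rewrite !tagnat.rankK.
  by move/eqP; rewrite -tag_eqE /tag_eq eqxx tagged_asE => /eqP.
rewrite (_ : submxrow _ _ = 0) ?mulmx0 //; apply/matrixP=> a b; rewrite !mxE.
case: eqP => [/(congr1 (@tagnat.sig1 _ _))|_]; last exact: rmorph0.
by rewrite !tagnat.Rank1K => ij; rewrite ij eqxx in nij.
Qed.
End Codes.

(** * Admissible parameters *)

Section Admissible.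
Variables (Fq : finFieldType) (F : fieldExtType Fq) (l : nat).
Local Notation q := #|Fq|.
Local Notation m := (\dim {:F}).
Hypothesis l_gt2 : (2 < l)%N.
Hypothesis l_dvd : (l %| m)%N.

Lemma subfield_order_dvd : ((q ^ l - 1) %| (q ^ m - 1))%N.
Proof.
case/dvdnP: l_dvd => t ->; rewrite mulnC expnM !subn1.
by rewrite [X in (_ %| X)%N]predn_exp dvdn_mulr.
Qed.

Lemma expf_order_pred (v : F) : v != 0 -> v ^+ (q ^ m - 1) = 1.
Proof.
move=> nzv; apply: (mulfI nzv); rewrite -exprS subn1 prednK ?expr_order ?mulr1 //.
by rewrite expn_gt0 ltnW ?order_gt1.
Qed.

(** Put [e = (q ^ m - 1) / (q ^ l - 1)] and [M = (q ^ (l - 1) - 1) * e].  Either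
    power condition on [g] would give [g ^+ M = 1] by Fermat, and as
    [M < q ^ m - 1] some nonzero [g] escapes this. *)
Lemma nonpower_exists : exists g : F, [/\ g != 0,
  ~ is_power (Cnum q 1 l) g & ~ is_power (q ^ l - 1) (g ^+ (q ^ (l - 1) - 1))].
Proof.
have q_gt1 := order_gt1 Fq.
have [e De] := dvdnP subfield_order_dvd.
have lt_l : (q ^ (l - 1) < q ^ l)%N by rewrite ltn_exp2l // ltn_subrL; lia.
have q_lt : (q ^ 1 <= q ^ (l - 1))%N by rewrite leq_exp2l //; lia.
have qm_gt1 : (1 < q ^ m)%N.
  by rewrite -{1}(exp1n m) ltn_exp2r ?dimF_gt0.
pose M := ((q ^ (l - 1) - 1) * e)%N.
have e_gt0 : (0 < e)%N by case: (e) De => // /eqP; lia.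
have leM : (M.+1 < q ^ m)%N.
  suff : (M < e * (q ^ l - 1))%N by rewrite -De; lia.
  by rewrite /M mulnC ltn_pmul2l //; lia.
have [||g] := @nonroot _ F ('X^(M.+1) - 'X).
- rewrite -size_poly_gt0 size_polyDl ?size_polyXn // size_polyN size_polyX.
  by rewrite !ltnS muln_gt0 e_gt0 andbT; lia.
- apply: leq_trans (size_polyD _ _) _; rewrite size_polyN size_polyX size_polyXn.
  by rewrite geq_max leM.
rewrite rootE !hornerE exprS -[X in _ - X]mulr1 -mulrBr mulf_eq0 negb_or subr_eq0.
case/andP=> nzg gM; exists g; split=> //.
- case=> v nzv Dg; case/eqP: gM.
  rewrite Dg -exprM /M -(Cnum_mul (l - 1)) //.
  have -> : (Cnum q 1 l * ((q - 1) * Cnum q 1 (l - 1) * e) =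
             (e * ((q - 1) * Cnum q 1 l)) * Cnum q 1 (l - 1))%N by ring.
  by rewrite Cnum_mul // -De exprM expf_order_pred // expr1n.
case=> v nzv Dg; case/eqP: gM.
by rewrite /M exprM Dg -exprM mulnC -De expf_order_pred.
Qed.

(** All entries are 1 but [alpha_3], the one entry whose exponent is 1 both in
    [kappa] and in [Pi_2]. *)
Definition spike (g : F) : l.-tuple F :=
  [tuple if i == 2 :> nat then g else 1 | i < l].

Lemma alpha_spike g i : alpha (spike g) i = if ((i + l).-1 %% l == 2)%N then g else 1.
Proof.
have lt_l : ((i + l).-1 %% l < l)%N by rewrite ltn_pmod //; lia.
rewrite /alpha -[X in _`_X]/(nat_of_ord (Ordinal lt_l)) -tnth_nth.
by rewrite tnth_mktuple.
Qed.

Lemma kappa_spike g : kappa (spike g) = g.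
Proof.
rewrite /kappa !alpha_spike.
have -> : ((1 + l).-1 %% l = 0)%N by rewrite add1n modnn.
have -> : ((2 + l).-1 %% l = 1)%N by rewrite /= addSn /= -addn1 modnDl modn_small; lia.
rewrite !expr1n mul1r divr1 big_ltn // subnn expr1 big_nat big1 => [|u /andP[u3 ul]].
  rewrite mulr1 alpha_spike -[(3 + l).-1]/(2 + l)%N modnDr modn_small ?eqxx //.
rewrite alpha_spike (_ : (u + l).-1 = u.-1 + l)%N; last by lia.
by rewrite modnDr modn_small ?ifN ?expr1n //; lia.
Qed.

Lemma Pi_spike2 g : Pi (spike g) 2 = g.
Proof.
have lt_l : (l.-1 < l)%N by lia.
rewrite /Pi (bigD1 (Ordinal lt_l)) //= big1 => [|j].
  rewrite alpha_spike mulr1 subn1 subnn expr1.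
  rewrite (_ : (2 + l - l.-1 + l).-1 = 2 + l)%N; last by lia.
  by rewrite modnDr modn_small.
rewrite -val_eqE /= => nj; have jl := ltn_ord j.
rewrite alpha_spike ifN ?expr1n //.
case: (ltnP j 2) => j2.
  rewrite (_ : (2 + l - j + l).-1 = (1 - j) + l + l)%N; last by lia.
  by rewrite !modnDr modn_small; lia.
rewrite (_ : (2 + l - j + l).-1 = (1 + l - j) + l)%N; last by lia.
by rewrite modnDr modn_small; lia.
Qed.

Lemma Pi_spike3 g : Pi (spike g) 3 = g ^+ (q ^ (l - 1)).
Proof.
have lt_l : (0 < l)%N by lia.
rewrite /Pi (bigD1 (Ordinal lt_l)) //= big1 => [|j].
  rewrite alpha_spike mulr1 !subn0.
  rewrite (_ : (3 + l + l).-1 = 2 + l + l)%N; last by lia.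
  by rewrite !modnDr modn_small.
rewrite -val_eqE /= => nj; have jl := ltn_ord j.
rewrite alpha_spike ifN ?expr1n //.
case: (ltnP j 3) => j3.
  rewrite (_ : (3 + l - j + l).-1 = (2 - j) + l + l)%N; last by lia.
  by rewrite !modnDr modn_small; lia.
rewrite (_ : (3 + l - j + l).-1 = (2 + l - j) + l)%N; last by lia.
by rewrite modnDr modn_small; lia.
Qed.

Lemma admissible_parameters : exists A : l.-tuple F,
  [/\ forall i, tnth A i != 0, ~ is_power (Cnum q 1 l) (kappa A)
    & exists delta, (1 <= delta <= l - 1)%N /\
        ~ is_power (q ^ l - 1) (Pi A (delta + 2) / Pi A 2)].
Proof.
have [g [nzg ngk ngp]] := nonpower_exists.
exists (spike g); split; rewrite ?kappa_spike //.
  by move=> i; rewrite tnth_mktuple; case: ifP => _; rewrite ?oner_eq0.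
exists 1%N; split; first by lia.
rewrite Pi_spike2 Pi_spike3; congr (~ is_power _ _): ngp.
apply: (mulIf nzg); rewrite divfK // -exprSr subn1 prednK //.
by rewrite expn_gt0 ltnW ?order_gt1.
Qed.
End Admissible.

(** * The theorem *)

Lemma HAB_graph (Fq : finFieldType) (F : fieldExtType Fq) l (A : l.-tuple F) n s
    (H0 : 'M[F]_(l + l, n)) (b : s.-tuple F) :
  basis_of (WA A) (cols H0) ->
  forall x, exists d : 'cV[Fq]_(n + s),
    graph_col A x = HAB H0 b *m map_mx (in_alg F) d.
Proof.
move=> /andP[/eqP spanW _] x; have : graphA A x \in WA A by apply/mem_WA; exists x.
rewrite -spanW => /mem_span_cols[d Dx]; exists (col_mx d^T 0).
rewrite map_col_mx map_mx0 mul_row_col mulmx0 addr0.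
apply: trmx_inj; rewrite trmx_mul map_trmx trmxK -Dx.
by apply/rowP=> i; rewrite !mxE.
Qed.

Theorem corollary5p2 (q l t m : nat) (Fq : finFieldType) (F : fieldExtType Fq)
    (hq : #|Fq| = q) (hl : (3 <= l)%N) (ht : (2 <= t)%N) (hm : m = (l * t)%N)
    (hF : \dim {:F} = m) :
  exists A : l.-tuple F,
    [/\ (forall i : 'I_l, tnth A i != 0),
        ~ is_power (Cnum q 1 l) (kappa A),
        (exists delta : nat, (1 <= delta <= l - 1)%N /\
           ~ is_power (q ^ l - 1)%N (Pi A (delta + 2)%N / Pi A 2))
      & forall (s : nat), (1 <= s)%N -> (2 * s < m - 2)%N ->
        forall (B : {vspace F}), \dim B = s ->
        forall (H0 : 'M[F]_(l + l, l * m)), basis_of (WA A) (cols H0) ->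
        forall (b : s.-tuple F), basis_of B b ->
        forall (k : nat) (G : 'M[F]_(k, l * m + s)),
          generator_matrix G (dual_code (HAB H0 b)) ->
        let U := <<cols G>>%VS in
        let D := dual_code G in
        [/\ k = (l * (m - 2) + s)%N,
            q_system (l * m + s) U,
            extremal_scattered (m - 3)%N U,
            (D == HAB H0 b)%MS
          & (exists2 d : nat, has_d2 D d & (2 * m - 4 <= d)%N) /\
            forall (s_ : 'I_l -> nat), (\sum_(i < l) s_ i)%N = s ->
            forall (r : nat) (C : 'M[F]_(r, l * m + s)),
              order_one_direct_sum s_ C -> ~ code_equiv D C]].
Proof.
subst q; have ml : (l %| \dim {:F})%N by rewrite hF hm dvdn_mulr.
have [A [nzA kappaA PiA]] := admissible_parameters hl ml.
have m_ge6 : (6 <= m)%N by rewrite hm (leq_mul hl ht).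
exists A; split=> // s s_gt0 s_lt B _ H0 basH0 b _ k G genG U D.
have H_graph := HAB_graph b basH0.
have l_gt1 := ltnW hl.
have weight1 c (Y : 'rV[F]_(l + l)) :
    Y != 0 -> thin c (Y *m HAB H0 b) -> (m - 1 <= c)%N.
  by move=> nzY thY; rewrite -hF; apply: word_support_ge thY.
have d_gt1 : (1 < m - 1)%N by lia.
have eqD : (D == HAB H0 b)%MS := dual_dual weight1 d_gt1 genG.
have weight2 c (V : 'M[F]_(2, l * m + s)) :
    row_free V -> (V <= D)%MS -> thin c V -> (2 * m - 4 <= c)%N.
  move=> fV sVD; have /andP[sDH _] := eqD.
  have /submxP[Y DV] := submx_trans sVD sDH; rewrite DV => thV.
  rewrite -hF; apply: plane_support_ge thV => //.
  by rewrite -row_leq_rank -{1}(eqP fV) DV mxrankM_maxl.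
have kE : k = (l * (m - 2) + s)%N.
  rewrite (generator_dim weight1 d_gt1 genG).
  suff : (l + l <= l * m)%N by rewrite mulnBr muln2 -addnn; lia.
  by rewrite addnn -muln2 leq_mul2l; lia.
have qsys := dual_q_system weight1 d_gt1 genG.
split=> //.
- split; first by apply: (dual_scattered weight1 d_gt1 genG); lia.
  have [dimU _] := qsys; rewrite dimU hF kE (_ : (m - 3).+1 = m - 2)%N; last by lia.
  rewrite mulnDl mulnAC divnMDl; last by lia.
  (* 2 * s < m - 2 makes the quotient exact up to this remainder *)
  have -> : (s * m = s * (m - 2) + 2 * s)%N by rewrite mulnBr; nia.
  by rewrite divnMDl ?divn_small ?addn0; lia.
split.
  have [|d d2D] := @d2_exists _ _ _ _ D.
    have /eqmxP -> := eqD.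
    by rewrite (eqP (weight_row_free weight1 d_gt1)); lia.
  exists d => //; case: d2D => [[V /andP[fV sV] <-] _].
  exact: weight2 fV sV (thin_Rsupp V).
(* a summand has support at most m + s, which is below 2 * m - 4 *)
move=> s_ sum_s r C dsC eqC.
have [V' [fV' sV' thV']] := direct_sum_thin (Ordinal (ltnW l_gt1)) dsC.
have [V [fV sV thV]] := equiv_thin eqC fV' sV' thV'.
have := weight2 _ _ fV sV thV.
suff : (s_ (Ordinal (ltnW l_gt1)) <= s)%N by rewrite hF; lia.
by rewrite -sum_s (bigD1 (Ordinal (ltnW l_gt1))) //= leq_addr.
Qed.
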